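(* For any real $p \ge 1$, we have $$\pi_p =\frac{2\,\Gamma\left(\frac{1}{p}\right)^2}{p\,\Gamma\left(\frac{2}{p}\right)}.$$ In particular, $\pi_p$ is a differentiable function of $p$.
   Context: For real $p\ge 1$, $\pi_p := 2\sin_p^{-1}(1) = 2\int_{0}^{1} \frac{1}{(1-t^p)^{\frac{p-1}{p}}}\,dt$. $\Gamma$ denotes the gamma function, $\Gamma(z)=\int_0^\infty e^{-t}t^{z-1}\,dt$ for $z>0$. *)

(* Defs.v *)
From HB Require Import structures.
From mathcomp Require Import all_boot all_order all_algebra.
From mathcomp Require Import all_classical all_reals all_analysis.

Set Implicit Arguments.
Unset Strict Implicit.
Unset Printing Implicit Defensive.

Import Order.TTheory GRing.Theory Num.Theory.
Import numFieldNormedType.Exports.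

Local Open Scope classical_set_scope.
Local Open Scope ring_scope.

(* For p > 1 the integrand is singular at t = 1, where it takes the value 0
   because 0 `^ a = 0 for a != 0 and 0^-1 = 0; the Lebesgue integral does not
   see this point. *)
Definition arcsin_p (R : realType) (p x : R) : R :=
  Rintegral (@lebesgue_measure R) `[0, x]
    (fun t => 1 / (1 - t `^ p) `^ ((p - 1) / p)).

Definition pi_p (R : realType) (p : R) : R := 2 * arcsin_p p 1.

Definition Gamma (R : realType) (z : R) : R :=
  Rintegral (@lebesgue_measure R) `]0, +oo[
    (fun t => expR (- t) * t `^ (z - 1)).

(* Differentiability at a of a function considered only on A: the difference
   quotient has a finite limit as q tends to a with q in A and q != a. It is
   the library's derivable f a 1 when a is interior to A, and one-sided
   differentiability at an endpoint of an interval. *)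
Definition derivable_within (R : realType) (A : set R) (f : R -> R) (a : R)
    : Prop :=
  cvg ((f q - f a) / (q - a) @[q --> within A a^']).

(* Main.v *)
Require Import Defs.
From mathcomp Require Import all_boot all_order all_algebra.
From mathcomp Require Import all_classical all_reals all_analysis.
From mathcomp Require Import measurable_realfun.
From mathcomp Require Import ring lra.

Import Order.TTheory GRing.Theory Num.Theory.
Import numFieldNormedType.Exports.

Local Open Scope classical_set_scope.
Local Open Scope ring_scope.

(** Write w = 1/p. The substitution t = (v / (1 + v)) ^ w carries ]0, +oo[ onto
    ]0, 1[ and turns the integral defining arcsin_p 1 into w * B(w, w), where
    B(a, b) is Euler's beta integral over the half-line
    (integral_arcsin_p1). The closed form of pi_p is then the classical
    identity Gamma a * Gamma b = B(a, b) * Gamma (a + b) at a = b = w. It comes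
    from putting y = x v in the inner integral of the double integral for
    Gamma a * Gamma b, exchanging the integrals by Tonelli, and rescaling x by
    1 + v (gamma_integralM). Everything is nonnegative, so the identity holds in
    the extended reals without any convergence argument; finiteness of Gamma on
    ]0, +oo[ then brings it back to real numbers.

    Finiteness of Gamma a uses the same substitution once more: the derivative
    of (t / (1 + t)) ^ a is a t^(a-1) (1 + t)^-(a+1), whose integral over the
    half-line is the length 1 of ]0, 1[, and it dominates e^-t t^(a-1) up to a
    constant because (1 + t)^(a+1) = O(e^t).

    For differentiability, the closed form reduces the claim to that of Gamma on
    ]0, +oo[, and Gamma is differentiated under the integral sign. Near a, the
    derivative e^-t t^(z-1) ln t of the integrand is dominated by a combination
    of the integrands of Gamma at a/4 and 3a, since |ln t| is at most
    (t^d + t^-d) / d for every d > 0 (derivable_Gamma). *)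

(** * Increasing changes of variables on the half-line *)

(** The integral over ]0, +oo[ is the limit of those over the segments
    [1/(n+1), n+1]. On each of them the compact change of variables applies,
    because continuity of f and G inside the open domains controls the
    endpoints; monotone convergence does the rest, so that neither F, f nor G
    need behave well at 0 or at infinity. *)
Lemma ge0_substitution_0y {R : realType} (F f G : R -> R) :
  (forall x : R, 0 < x -> is_derive x 1 F (f x)) ->
  (forall x : R, 0 < x -> 0 < f x) ->
  (forall x : R, 0 < x -> {for x, continuous f}) ->
  (forall x : R, 0 < x -> {for F x, continuous G}) ->
  (forall x : R, 0 < x -> 0 <= G (F x)) ->
  (\int[lebesgue_measure]_(y in [set F x | x in `]0%R, +oo[]) (G y)%:E =
   \int[lebesgue_measure]_(x in `]0%R, +oo[) (G (F x) * f x)%:E)%E.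
Proof.
move=> dF f_gt0 cf cG G_ge0.
have derF (x : R) : 0 < x -> F^`()%classic x = f x.
  by move=> x0; rewrite derive1E; have [_ ->] := dF x x0.
have derivF (x : R) : 0 < x -> derivable F x 1 by move=> /dF[].
have cF (x : R) : 0 < x -> {for x, continuous F}.
  by move=> x0; exact/differentiable_continuous/derivable1_diffP/derivF.
have incF (x y : R) : 0 < x -> x < y -> F x < F y.
  move=> x0 xy; apply: (@gtr0_derive1_incr _ F x y) => //.
  - by move=> z; rewrite in_itv/= => /andP[xz _]; exact/derivF/(lt_trans x0).
  - move=> z; rewrite in_itv/= => /andP[xz _].
    by rewrite derF; [exact/f_gt0/(lt_trans x0)|exact: (lt_trans x0)].
  - apply: derivable_within_continuous => z.
    by rewrite in_itv/= => /andP[xz _]; exact/derivF/(lt_le_trans x0).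
have leF (x y : R) : 0 < x -> x <= y -> F x <= F y.
  by move=> x0; rewrite le_eqVlt => /predU1P[->//|/(incF _ _ x0)/ltW].
pose a n : R := n.+1%:R^-1; pose b n : R := n.+1%:R.
have a_gt0 n : 0 < a n by rewrite invr_gt0 ltr0Sn.
have b_gt0 n : 0 < b n by rewrite ltr0Sn.
have ab n : a n <= b n.
  by rewrite (@le_trans _ _ 1)//= ?/a ?/b ?invf_le1 ?ltr0Sn// ler1n.
have a_noninc m n : (m <= n)%N -> a n <= a m.
  by move=> mn; rewrite /a lef_pV2 ?posrE ?ltr0Sn// ler_nat.
have b_nondec m n : (m <= n)%N -> b m <= b n by move=> mn; rewrite ler_nat.
(* An index beyond both x and 1/x captures x. *)
have in_ab (x : R) : 0 < x -> exists n, a n <= x <= b n.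
  move=> x0; have x'0 : 0 <= Num.max x x^-1 by rewrite le_max (ltW x0).
  exists (Num.truncn (Num.max x x^-1)).
  have := truncnS_gt (Num.max x x^-1).
  rewrite gt_max => /andP[/ltW xb /ltW xa]; rewrite xb andbT.
  by rewrite -[leRHS]invrK lef_pV2// posrE ?ltr0Sn// invr_gt0.
have dom : \bigcup_n `[a n, b n]%classic = `]0, +oo[%classic :> set R.
  apply/seteqP; split => [x [n _]|x]/=; rewrite !in_itv/= ?andbT.
    by move=> /andP[/(lt_le_trans (a_gt0 n))].
  by move=> /in_ab[n nx]; exists n => //=; rewrite in_itv.
have img : \bigcup_n `[F (a n), F (b n)]%classic = [set F x | x in `]0, +oo[].
  apply/seteqP; split => [y [n _]|_ [x /= x0 <-]]/=.
    rewrite in_itv/= => yab.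
    have cFab : {within `[a n, b n], continuous F}.
      apply: derivable_within_continuous => z; rewrite in_itv/= => /andP[az _].
      exact/derivF/(lt_le_trans (a_gt0 n)).
    have [|x xab <-] := IVT (ab n) cFab (v := y).
      have Fab : F (a n) <= F (b n) by exact: leF.
      by rewrite min_l// max_r.
    exists x => //=; move: xab; rewrite !in_itv/= andbT => /andP[ax _].
    exact: (lt_le_trans (a_gt0 n)).
  move: x0; rewrite in_itv/= andbT => /in_ab[n /andP[ax xb]].
  exists n => //=; rewrite in_itv/= leF//=; apply: leF => //.
  exact: (lt_le_trans (a_gt0 n)).
have xgt0 n (x : R) : x \in `[a n, b n] -> 0 < x.
  by rewrite in_itv/= => /andP[/(lt_le_trans (a_gt0 n))].
have imgP n (y : R) : y \in `[F (a n), F (b n)] -> exists2 x, 0 < x & F x = y.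
  move=> yn; have : (\bigcup_n `[F (a n), F (b n)]%classic) y by exists n.
  by rewrite img => -[x/=]; rewrite in_itv/= andbT => x0 <-; exists x.
have cGn n : {within `[F (a n), F (b n)], continuous G}.
  by apply: continuous_in_subspaceT => y /[!inE]/= /imgP[x x0 <-]; exact: cG.
have cGFn n : {within `[a n, b n], continuous (fun x => G (F x) * f x)}.
  apply: continuous_in_subspaceT => x /[!inE]/= /xgt0 x0.
  apply: cvgM; last exact: cf.
  by apply: (@continuous_comp _ _ _ F G); [exact: cF|exact: cG].
have eqn n : (\int[lebesgue_measure]_(y in `[F (a n), F (b n)]) (G y)%:E =
    \int[lebesgue_measure]_(x in `[a n, b n]) (G (F x) * f x)%:E)%E.
  have nearf (x : R) : 0 < x -> F^`()%classic x @[x --> x] --> f x.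
    move=> x0; apply: cvg_trans (cf x x0); apply: near_eq_cvg; near=> z.
    by rewrite derF//; near: z; exact: lt_nbhsr.
  rewrite integration_by_substitution_increasing//.
  - by apply: eq_integral => x /[!inE]/= /xgt0 x0; rewrite fctE derF.
  - by move=> x y /xgt0 x0 _; exact: incF.
  - move=> x xab; have x0 : 0 < x by apply: (xgt0 n); exact: subset_itv_oo_cc.
    by rewrite /continuous_at derF//; exact: nearf.
  - by apply/cvg_ex; exists (f (a n)); exact/cvg_at_right_filter/nearf.
  - by apply/cvg_ex; exists (f (b n)); exact/cvg_at_left_filter/nearf.
  - split.
    + move=> x xab; apply/derivF/(xgt0 n); exact: subset_itv_oo_cc.
    + exact/cvg_at_right_filter/cF.
    + exact/cvg_at_left_filter/cF.
rewrite -img -dom.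
have cvgL : (\int[lebesgue_measure]_(y in `[F (a n), F (b n)]) (G y)%:E
    @[n --> \oo] --> \int[lebesgue_measure]_(y in
      \bigcup_n `[F (a n), F (b n)]%classic) (G y)%:E)%E.
  apply: ge0_nondecreasing_set_cvg_integral => //.
  - move=> m n mn; rewrite subsetEset; apply: subset_itv; rewrite bnd_simp.
      by apply: leF => //; exact: a_noninc.
    by apply: leF => //; exact: b_nondec.
  - move=> n; apply/measurable_EFinP.
    exact: (subspace_continuous_measurable_fun (measurable_itv _) (@cGn n)).
  - by move=> n x /imgP[z z0 <-]; rewrite lee_fin; exact: G_ge0.
rewrite (funext eqn) in cvgL.
rewrite -(cvg_lim _ cvgL)//; apply/cvg_lim => //.
apply: ge0_nondecreasing_set_cvg_integral => //.
- move=> m n mn; rewrite subsetEset; apply: subset_itv; rewrite bnd_simp.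
    exact: a_noninc.
  exact: b_nondec.
- move=> n; apply/measurable_EFinP.
  exact: (subspace_continuous_measurable_fun (measurable_itv _) (@cGFn n)).
- move=> n x /xgt0 x0; rewrite lee_fin mulr_ge0//; first exact: G_ge0.
  exact/ltW/f_gt0.
Unshelve. all: by end_near. Qed.

Lemma ge0_integral_scale {R : realType} (c : R) (G : R -> R) : 0 < c ->
  {in `]0, +oo[, continuous G} -> {in `]0, +oo[, forall y, 0 <= G y} ->
  (\int[lebesgue_measure]_(y in `]0%R, +oo[) (G y)%:E =
   \int[lebesgue_measure]_(x in `]0%R, +oo[) (G (c * x) * c)%:E)%E.
Proof.
move=> c0 cG G0.
have cx (x : R) : 0 < x -> c * x \in `]0, +oo[.
  by move=> x0; rewrite in_itv/= andbT mulr_gt0.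
have img : [set c * x | x in `]0, +oo[] = `]0, +oo[%classic.
  apply/seteqP; split => [_ [x /= + <-]|y /=]; rewrite ?in_itv/= ?andbT.
    by move=> /cx; rewrite in_itv andbT.
  move=> y0; exists (c^-1 * y); last by rewrite mulrA divff ?gt_eqF// mul1r.
  by rewrite /= in_itv/= andbT mulr_gt0// invr_gt0.
rewrite -[in LHS]img.
apply: (ge0_substitution_0y (fun x : R => c * x) (cst c) G) => //.
- move=> x _; have := is_deriveZ c (is_derive_id x (1 : R)).
  by rewrite /GRing.scale/= mulr1.
- by move=> x _; exact: cst_continuous.
- by move=> x /cx; exact: cG.
- by move=> x /cx; exact: G0.
Qed.

(** * The substitution (v / (1 + v)) ^ w *)

Lemma continuous_powR_gt0 {R : realType} (a x : R) : 0 < x ->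
  {for x, continuous (fun y : R => y `^ a)}.
Proof.
move=> x0; apply/differentiable_continuous/derivable1_diffP.
by have [] := is_derive1_powR a x0.
Qed.

Lemma is_derive_powR_odds {R : realType} (w v : R) : 0 < v ->
  is_derive v 1 (fun x : R => (x / (1 + x)) `^ w)
    (w * (v `^ (w - 1) * (1 + v) `^ (- (w + 1)))).
Proof.
move=> v0; have v1 : 0 < 1 + v by rewrite addr_gt0.
have dD : is_derive v 1 (fun x : R => 1 + x) 1.
  have := is_deriveD (is_derive_cst (1 : R) v 1) (is_derive_id v 1).
  by rewrite add0r.
have dV := is_deriveV (f := fun x : R => 1 + x) (lt0r_neq0 v1) dD.
have dQ := is_deriveM (f := id) (g := fun x : R => (1 + x)^-1)
  (is_derive_id v 1) dV.
have q0 : 0 < v / (1 + v) by exact: divr_gt0.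
have dP := is_derive1_powR w q0.
have := is_derive1_comp (f := fun y => y `^ w) (g := fun x : R => x / (1 + x))
  (x := v) dP dQ.
move=> /is_derive_eq; apply.
rewrite /GRing.scale/= mulr1 powRM ?invr_ge0 ?ltW//.
rewrite -mulrA; congr (w * _); rewrite -mulrA; congr (_ * _).
have -> : v * - (1 + v) ^- 2 + (1 + v)^-1 * 1 = (1 + v) `^ (- 2).
  by rewrite powRN powR_mulrn ?ltW//; field; rewrite gt_eqF.
rewrite -powR_inv1 ?ltW// -powRrM -powRD; last by rewrite (gt_eqF v1) implybT.
by congr (_ `^ _); ring.
Qed.

(** The preimage of y is s / (1 - s) with s = y ^ (1/w). *)
Lemma image_powR_odds {R : realType} (w : R) : 0 < w ->
  [set (x / (1 + x)) `^ w | x in `]0, +oo[] = `]0, 1[%classic.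
Proof.
move=> w0; have powR1E r : 1 `^ r = 1 :> R by rewrite powR1.
apply/seteqP; split => [_ [v /= + <-]|y /=]; rewrite !in_itv/= ?andbT.
  move=> v0; have v1 : 0 < 1 + v by rewrite addr_gt0.
  rewrite powR_gt0 ?divr_gt0//= -[ltRHS](powR1E w).
  rewrite gt0_ltr_powR ?nnegrE ?divr_ge0 ?ltW//.
  by rewrite ltr_pdivrMr// mul1r ltrDr.
move=> /andP[y0 y1]; pose s := y `^ w^-1.
have s0 : 0 < s by exact: powR_gt0.
have s1 : s < 1.
  by rewrite -[ltRHS](powR1E w^-1) gt0_ltr_powR ?invr_gt0 ?nnegrE ?ltW.
exists (s / (1 - s)); first by rewrite in_itv/= andbT divr_gt0// subr_gt0.
have -> : s / (1 - s) / (1 + s / (1 - s)) = s by field; lra.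
by rewrite -powRrM mulVf ?gt_eqF// powRr1// ltW.
Qed.

Lemma ge0_substitution_powR_odds {R : realType} (w : R) (G : R -> R) : 0 < w ->
  {in `]0, 1[, continuous G} -> {in `]0, 1[, forall y, 0 <= G y} ->
  (\int[lebesgue_measure]_(y in `]0%R, 1%R[) (G y)%:E =
   \int[lebesgue_measure]_(x in `]0%R, +oo[)
     (G ((x / (1 + x)) `^ w) *
      (w * (x `^ (w - 1) * (1 + x) `^ (- (w + 1)))))%:E)%E.
Proof.
move=> w0 cG G0.
have in01 (x : R) : 0 < x -> (x / (1 + x)) `^ w \in `]0, 1[.
  move=> x0; suff : `]0, 1[%classic ((x / (1 + x)) `^ w) by [].
  by rewrite -(image_powR_odds w w0); exists x => //=; rewrite in_itv/= x0.
rewrite -(image_powR_odds w w0).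
apply: (ge0_substitution_0y (fun x : R => (x / (1 + x)) `^ w)
  (fun x => w * (x `^ (w - 1) * (1 + x) `^ (- (w + 1)))) G).
- by move=> x; exact: is_derive_powR_odds.
- by move=> x x0; rewrite !mulr_gt0// powR_gt0// addr_gt0.
- move=> x x0; apply: cvgM; first exact: cvg_cst.
  apply: cvgM; first exact: continuous_powR_gt0.
  apply: (@continuous_comp _ _ _ (fun x : R => 1 + x)
    (fun y : R => y `^ (- (w + 1)))).
    by apply: cvgD; [exact: cvg_cst|exact: cvg_id].
  by apply: continuous_powR_gt0; rewrite addr_gt0.
- by move=> x /in01; exact: cG.
- by move=> x /in01; exact: G0.
Qed.

(** * The integrands of Euler's integrals *)

Definition gamma_integrand {R : realType} (a t : R) : R :=
  expR (- t) * t `^ (a - 1).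

Lemma gamma_integrand_ge0 {R : realType} (a t : R) : 0 <= gamma_integrand a t.
Proof. by rewrite mulr_ge0 ?expR_ge0 ?powR_ge0. Qed.

Lemma measurable_gamma_integrand {R : realType} (a : R) :
  measurable_fun setT (gamma_integrand a).
Proof.
apply: measurable_funM; last exact: measurable_powR.
by apply: measurableT_comp => //; exact: measurable_oppr.
Qed.

(** The right-hand side is a constant times the derivative of
    (t / (1 + t)) ^ a, whose integral over the half-line is known. The
    inequality amounts to (1 + t)^(a+1) <= (a + 1)^(a+1) e^t, the (a+1)-st power
    of 1 + t <= (a + 1) (1 + t / (a + 1)) <= (a + 1) e^(t/(a+1)). *)
Lemma gamma_integrand_le {R : realType} (a t : R) : 0 < a -> 0 < t ->
  gamma_integrand a t <=
    (a + 1) `^ (a + 1) / a * (a * (t `^ (a - 1) * (1 + t) `^ (- (a + 1)))).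
Proof.
move=> a0 t0; have a1 : 0 < a + 1 by rewrite addr_gt0.
have t1 : 0 < 1 + t by rewrite addr_gt0.
rewrite mulrA divfK ?gt_eqF// /gamma_integrand mulrCA mulrC.
rewrite ler_wpM2l ?powR_ge0// powRN expRN.
rewrite ler_pdivlMr ?powR_gt0// mulrC ler_pdivrMr ?expR_gt0//.
have -> : expR t = expR (t / (a + 1)) `^ (a + 1).
  by rewrite -expRM divfK ?gt_eqF.
rewrite -powRM ?expR_ge0 ?(ltW a1)//.
apply: ge0_ler_powR; rewrite ?nnegrE ?(ltW a1) ?(ltW t1)//.
  by rewrite mulr_ge0 ?expR_ge0 ?(ltW a1).
have := expR_ge1Dx (t / (a + 1)); rewrite -(ler_pM2l a1) mulrDr mulr1 mulrCA.
rewrite divff ?gt_eqF// mulr1; lra.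
Qed.

Lemma integrable_gamma_integrand {R : realType} (a : R) : 0 < a ->
  lebesgue_measure.-integrable `]0%R, +oo[ (EFin \o gamma_integrand a).
Proof.
move=> a0; apply/integrableP; split.
  apply/measurable_EFinP/measurable_funTS.
  exact: measurable_gamma_integrand.
have mg : measurable_fun setT
    (fun x : R => x `^ (a - 1) * (1 + x) `^ (- (a + 1))).
  apply: measurable_funM; first exact: measurable_powR.
  apply: (measurableT_comp (measurable_powR (- (a + 1)))).
  exact: measurable_funD.
pose c := (a + 1) `^ (a + 1) / a; have c0 : 0 <= c.
  by rewrite divr_ge0 ?powR_ge0 ?ltW.
apply: (@le_lt_trans _ _
    (c%:E * \int[lebesgue_measure]_(y in `]0%R, 1%R[) 1)%E).
  (* The length of ]0, 1[ is the integral of the derivative of (t/(1+t))^a. *)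
  rewrite (@ge0_substitution_powR_odds _ a (cst 1))//; last first.
    by move=> x _; exact: cst_continuous.
  rewrite -ge0_integralZl_EFin//=; last 2 first.
  - move=> x _; rewrite lee_fin mul1r mulr_ge0 ?(ltW a0)//.
    by rewrite mulr_ge0 ?powR_ge0.
  - apply/measurable_EFinP/measurable_funTS.
    by apply: measurable_funM => //; apply: measurable_funM.
  apply: ge0_le_integral => //=.
  - apply/measurable_EFinP/measurable_funTS.
    by apply: measurableT_comp => //; exact: measurable_gamma_integrand.
  - apply/measurable_EFinP/measurable_funTS.
    by do 3!apply: measurable_funM => //.
  - move=> x; rewrite in_itv/= andbT => x0.
    rewrite ger0_norm ?gamma_integrand_ge0// -EFinM lee_fin mul1r.
    exact: gamma_integrand_le.
rewrite integral_cst//= lebesgue_measure_itv/= lte_fin ltr01.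
by rewrite mul1e -EFinB -EFinM ltry.
Qed.

Lemma continuous_gamma_integrand {R : realType} (a : R) :
  {in `]0, +oo[, continuous (gamma_integrand a)}.
Proof.
move=> t; rewrite in_itv/= andbT => t0; apply: cvgM.
  apply: (@continuous_comp _ _ _ (fun x : R => - x) expR).
    exact: oppr_continuous.
  exact: continuous_expR.
exact: continuous_powR_gt0.
Qed.

(** Euler's beta integral B(a, b) of s^(b-1) (1-s)^(a-1) over ]0, 1[ becomes the
    integral of this function over ]0, +oo[ under s = v / (1 + v). *)
Definition beta_integrand {R : realType} (a b v : R) : R :=
  v `^ (b - 1) * (1 + v) `^ (- (a + b)).

Lemma beta_integrand_ge0 {R : realType} (a b v : R) : 0 <= beta_integrand a b v.
Proof. by rewrite mulr_ge0 ?powR_ge0. Qed.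

Lemma measurable_beta_integrand {R : realType} (a b : R) :
  measurable_fun setT (beta_integrand a b).
Proof.
apply: measurable_funM; first exact: measurable_powR.
apply: (measurableT_comp (measurable_powR (- (a + b)))).
exact: measurable_funD.
Qed.

(** The left-hand side is the integrand of the double integral for
    Gamma a * Gamma b after the substitution y = x v, of Jacobian x; the
    right-hand side separates v from (1 + v) x. *)
Lemma gamma_integrandM {R : realType} (a b x v : R) : 0 < x -> 0 < v ->
  gamma_integrand a x * (gamma_integrand b (x * v) * x) =
  beta_integrand a b v * (gamma_integrand (a + b) ((1 + v) * x) * (1 + v)).
Proof.
move=> x0 v0; have v1 : 0 < 1 + v by rewrite addr_gt0.
rewrite /gamma_integrand /beta_integrand !powRM ?(ltW x0) ?(ltW v0) ?(ltW v1)//.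
have -> : expR (- ((1 + v) * x)) = expR (- x) * expR (- (x * v)).
  by rewrite -expRD; congr expR; ring.
have -> : x `^ (a + b - 1) = x `^ (a - 1) * (x `^ (b - 1) * x).
  rewrite -{4}[x]powRr1 ?(ltW x0)// -!powRD ?(gt_eqF x0) ?implybT//.
  by congr (_ `^ _); ring.
have e : (1 + v) `^ (- (a + b)) * (1 + v) `^ (a + b - 1) * (1 + v) = 1.
  rewrite -{3}[1 + v]powRr1 ?(ltW v1)// -!powRD ?(gt_eqF v1) ?implybT//.
  by rewrite (_ : - (a + b) + (a + b - 1) + 1 = 0) ?powRr0//; ring.
rewrite -[LHS]mulr1 -[X in _ * X = _]e; ring.
Qed.

(** * The product formula for Gamma *)

(** Extending f by zero outside the rectangle reduces this to Tonelli on the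
    whole product space. *)
Lemma fubini_tonelli_rectangle {d1 d2 : measure_display}
    {T1 : measurableType d1} {T2 : measurableType d2} {R : realType}
    (m1 : {sigma_finite_measure set T1 -> \bar R})
    (m2 : {sigma_finite_measure set T2 -> \bar R})
    (A : set T1) (B : set T2) (f : T1 * T2 -> \bar R) :
  measurable A -> measurable B ->
  measurable_fun (A `*` B) f -> (forall z, (A `*` B) z -> 0 <= f z)%E ->
  (\int[m1]_(x in A) \int[m2]_(y in B) f (x, y) =
   \int[m2]_(y in B) \int[m1]_(x in A) f (x, y))%E.
Proof.
move=> mA mB mf f0; have mAB : measurable (A `*` B) by exact: measurableX.
have mh : measurable_fun setT (f \_ (A `*` B)).
  exact/(measurable_restrictT f).
have h0 z : (0 <= (f \_ (A `*` B)) z)%E by 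
  by rewrite patchE; case: ifPn => // /set_mem; exact: f0.
transitivity (\int[m1]_x \int[m2]_y (f \_ (A `*` B)) (x, y))%E.
  rewrite [LHS]integral_mkcond; apply: eq_integral => x _; rewrite patchE.
  case: ifPn => xA.
    rewrite [LHS]integral_mkcond; apply: eq_integral => y _.
    by rewrite !patchE in_setX xA.
  by apply/esym/integral0_eq => y _; rewrite patchE in_setX (negbTE xA).
rewrite (fubini_tonelli (m1 := m1) (m2 := m2) _ mh h0).
rewrite [RHS]integral_mkcond; apply: eq_integral => y _; rewrite patchE.
case: ifPn => yB.
  rewrite [RHS]integral_mkcond; apply: eq_integral => x _.
  by rewrite !patchE in_setX yB andbT.
by apply: integral0_eq => x _; rewrite patchE in_setX (negbTE yB) andbF.
Qed.

(** Extended-real values, so that Tonelli's theorem gives identities between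
    these integrals before any of them is known to be finite. *)
Definition gamma_integral {R : realType} (a : R) : \bar R :=
  (\int[lebesgue_measure]_(t in `]0%R, +oo[) (gamma_integrand a t)%:E)%E.

Definition beta_integral {R : realType} (a b : R) : \bar R :=
  (\int[lebesgue_measure]_(v in `]0%R, +oo[) (beta_integrand a b v)%:E)%E.

Lemma gamma_integral_ge0 {R : realType} (a : R) : (0 <= gamma_integral a)%E.
Proof. by apply: integral_ge0 => t _; rewrite lee_fin gamma_integrand_ge0. Qed.

Lemma beta_integral_ge0 {R : realType} (a b : R) : (0 <= beta_integral a b)%E.
Proof. by apply: integral_ge0 => t _; rewrite lee_fin beta_integrand_ge0. Qed.

(** Gamma a * Gamma b = B(a, b) * Gamma (a + b), by the two rescalings y = x v
    and t = (1 + v) x around an exchange of the order of integration. *)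
Lemma gamma_integralM {R : realType} (a b : R) :
  (gamma_integral a * gamma_integral b =
   beta_integral a b * gamma_integral (a + b))%E.
Proof.
have mI : measurable (`]0, +oo[ : set R) by [].
have mg : measurable_fun (`]0, +oo[ : set R) (EFin \o gamma_integrand a).
  apply/measurable_EFinP/measurable_funTS; exact: measurable_gamma_integrand.
have mb : measurable_fun (`]0, +oo[ : set R) (EFin \o beta_integrand a b).
  apply/measurable_EFinP/measurable_funTS; exact: measurable_beta_integrand.
have g0 (t : R) : `]0, +oo[%classic t -> (0 <= (gamma_integrand a t)%:E)%E.
  by rewrite lee_fin gamma_integrand_ge0.
have b0 (t : R) : `]0, +oo[%classic t -> (0 <= (beta_integrand a b t)%:E)%E.
  by rewrite lee_fin beta_integrand_ge0.
rewrite [LHS]muleC [RHS]muleC.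
have := ge0_integralZl lebesgue_measure mI mg g0 (gamma_integral_ge0 b).
rewrite -/(gamma_integral a) => <-.
have := ge0_integralZl lebesgue_measure mI mb b0 (gamma_integral_ge0 (a + b)).
rewrite -/(beta_integral a b) => <-.
(* h is the integrand in the coordinates (x, v) with y = x v. *)
pose h (z : R * R) :=
  (gamma_integrand a z.1 * (gamma_integrand b (z.1 * z.2) * z.1))%:E.
transitivity (\int[lebesgue_measure]_(x in `]0%R, +oo[)
    \int[lebesgue_measure]_(v in `]0%R, +oo[) h (x, v))%E.
  apply: eq_integral => x; rewrite inE/= in_itv/= andbT => x0.
  rewrite muleC /gamma_integral (ge0_integral_scale x)//; last 2 first.
  - exact: continuous_gamma_integrand.
  - by move=> y _; exact: gamma_integrand_ge0.
  rewrite -ge0_integralZl_EFin//.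
  - by move=> v _; rewrite lee_fin mulr_ge0 ?gamma_integrand_ge0 ?ltW.
  - apply/measurable_EFinP/measurable_funTS/measurable_funM => //.
    apply: (measurableT_comp (measurable_gamma_integrand b)).
    exact: measurable_funM.
  - exact: gamma_integrand_ge0.
etransitivity.
  apply: (fubini_tonelli_rectangle lebesgue_measure lebesgue_measure _ _ h)
    => //.
    apply/measurable_EFinP/measurable_funTS; apply: measurable_funM.
      apply: (measurableT_comp (measurable_gamma_integrand a)).
      exact: measurable_fst.
    apply: measurable_funM; last exact: measurable_fst.
    apply: (measurableT_comp (measurable_gamma_integrand b)).
    exact: (measurable_funM measurable_fst measurable_snd).
  move=> [x v] [/= + _]; rewrite in_itv/= andbT => x0.
  rewrite lee_fin mulr_ge0 ?gamma_integrand_ge0//=.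
  by rewrite mulr_ge0 ?gamma_integrand_ge0// ltW.
apply: eq_integral => v; rewrite inE/= in_itv/= andbT => v0.
have v1 : 0 < 1 + v by rewrite addr_gt0.
rewrite muleC /gamma_integral (ge0_integral_scale (1 + v))//; last 2 first.
- exact: continuous_gamma_integrand.
- by move=> y _; exact: gamma_integrand_ge0.
rewrite -ge0_integralZl_EFin//.
- apply: eq_integral => x; rewrite inE/= in_itv/= andbT => x0.
  by rewrite /h/= gamma_integrandM// EFinM.
- by move=> x _; rewrite lee_fin mulr_ge0 ?gamma_integrand_ge0 ?ltW.
- apply/measurable_EFinP/measurable_funTS/measurable_funM => //.
  apply: (measurableT_comp (measurable_gamma_integrand (a + b))).
  exact: measurable_funM.
- exact: beta_integrand_ge0.
Qed.

(** * The closed form of pi_p *)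

Lemma gamma_integralE {R : realType} (a : R) : 0 < a ->
  gamma_integral a = (Gamma a)%:E.
Proof.
move=> a0; rewrite /gamma_integral fineK//; apply: integrable_fin_num => //.
exact: integrable_gamma_integrand.
Qed.

(** On ]1, 2[ the integrand is at least e^-2 / 2, because t^(a-1) >= t^-1. *)
Lemma Gamma_gt0 {R : realType} (a : R) : 0 < a -> 0 < Gamma a.
Proof.
move=> a0; pose k := expR (- 2 : R) * 2^-1.
have k0 : 0 < k by rewrite mulr_gt0 ?expR_gt0 ?invr_gt0.
have mg D : measurable D -> measurable_fun D (EFin \o gamma_integrand a).
  move=> mD; apply/measurable_EFinP/measurable_funTS.
  exact: measurable_gamma_integrand.
apply: (lt_le_trans k0); rewrite -lee_fin -gamma_integralE//.
apply: (@le_trans _ _ (\int[lebesgue_measure]_(t in `]1%R, 2%R[) k%:E)%E).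
  rewrite integral_cst//= lebesgue_measure_itv/= lte_fin ltr1n.
  by rewrite -EFinB -EFinM lee_fin addrK mulr1.
apply: (@le_trans _ _ (\int[lebesgue_measure]_(t in `]1%R, 2%R[)
    (gamma_integrand a t)%:E)%E).
  apply: ge0_le_integral => //=.
  - by move=> t _; rewrite lee_fin ltW.
  - exact: mg.
  move=> t; rewrite in_itv/= => /andP[t1 t2]; have t0 := lt_trans ltr01 t1.
  rewrite lee_fin ler_pM ?expR_ge0 ?invr_ge0//.
    by rewrite ler_expR lerN2 ltW.
  apply: (@le_trans _ _ (t `^ (-1))).
    by rewrite powR_inv1 ?ltW// ltf_pV2 ?posrE.
  by rewrite ler_powR ?(ltW t1)// lerBrDl addrN ltW.
apply: ge0_subset_integral => //=.
- exact: mg.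
- by move=> t _; rewrite lee_fin gamma_integrand_ge0.
- by move=> t /=; rewrite !in_itv/= andbT => /andP[/(lt_trans ltr01)].
Qed.

(** Under t = (v / (1 + v)) ^ (1/p) one has 1 - t^p = 1 / (1 + v), so the
    singular factor of the integrand is again a power of 1 + v. *)
Lemma integral_arcsin_p1 {R : realType} (p : R) : 0 < p ->
  (\int[lebesgue_measure]_(t in `[0%R, 1%R])
     (1 / (1 - t `^ p) `^ ((p - 1) / p))%:E =
   p^-1%:E * beta_integral p^-1 p^-1)%E.
Proof.
move=> p0; have pn0 : p != 0 by rewrite gt_eqF.
have eG (t : R) :
    1 / (1 - t `^ p) `^ ((p - 1) / p) = (1 - t `^ p) `^ (p^-1 - 1).
  by rewrite div1r -powRN; congr (_ `^ _); field.
under eq_integral do rewrite eG.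
have mG : measurable_fun setT (fun t : R => (1 - t `^ p) `^ (p^-1 - 1)).
  apply: (measurableT_comp (measurable_powR _)); apply: measurable_funB => //.
rewrite integral_itv_bndoo; last exact/measurable_EFinP/measurable_funTS.
rewrite (ge0_substitution_powR_odds p^-1) ?invr_gt0//; last 2 first.
- move=> t; rewrite in_itv/= => /andP[t0 t1].
  apply: (@continuous_comp _ _ _ (fun t : R => 1 - t `^ p)
    (fun y : R => y `^ (p^-1 - 1))).
    by apply: cvgB; [exact: cvg_cst|exact: continuous_powR_gt0].
  apply: continuous_powR_gt0; rewrite subr_gt0.
  have <- : 1 `^ p = 1 :> R by rewrite powR1.
  by rewrite gt0_ltr_powR ?nnegrE ?ltW.
- by move=> t _; rewrite powR_ge0.
rewrite -ge0_integralZl_EFin//; last 3 first.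
- by move=> v _; rewrite lee_fin beta_integrand_ge0.
- apply/measurable_EFinP/measurable_funTS; exact: measurable_beta_integrand.
- by rewrite invr_ge0 ltW.
apply: eq_integral => x; rewrite inE/= in_itv/= andbT => x0.
have x1 : 0 < 1 + x by rewrite addr_gt0.
rewrite -powRrM mulVf// powRr1 ?divr_ge0 ?ltW//.
have -> : 1 - x / (1 + x) = (1 + x) `^ (-1).
  by rewrite powR_inv1 ?(ltW x1)//; field; rewrite gt_eqF.
rewrite -EFinM; congr EFin; rewrite mulrCA; congr (_ * _).
rewrite mulrCA; congr (_ * _).
rewrite -powRrM -powRD; last by rewrite (gt_eqF x1) implybT.
by congr (_ `^ _); ring.
Qed.

Lemma pi_pE {R : realType} (p : R) : 0 < p ->
  pi_p p = 2 * Gamma (1 / p) ^+ 2 / (p * Gamma (2 / p)).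
Proof.
move=> p0; have w0 : 0 < p^-1 by rewrite invr_gt0.
have w20 : 0 < p^-1 + p^-1 by rewrite addr_gt0.
have -> : 2 / p = p^-1 + p^-1 by field; rewrite gt_eqF.
have Gn0 := lt0r_neq0 (Gamma_gt0 (p^-1 + p^-1) w20).
have := gamma_integralM p^-1 p^-1; rewrite !gamma_integralE// div1r.
have := beta_integral_ge0 p^-1 p^-1.
rewrite /pi_p /arcsin_p /Rintegral integral_arcsin_p1//.
(* An infinite beta integral would make Gamma (1/p) infinite. *)
case: (beta_integral _ _) => [b _|_|//]; last first.
  by rewrite gt0_mulye ?lte_fin ?Gamma_gt0.
move=> [e] /=; rewrite expr2 e; field.
by rewrite Gn0 gt_eqF.
Qed.

(** * Differentiability *)

Lemma is_derive_gamma_integrand {R : realType} (z t : R) : 0 < t ->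
  is_derive z 1 (fun x : R => gamma_integrand x t)
    (gamma_integrand z t * ln t).
Proof.
move=> t0; have tn0 : t != 0 by rewrite gt_eqF.
have -> : (fun x : R => gamma_integrand x t) =
    (fun x => expR (- t) * expR ((x - 1) * ln t)).
  by apply/funext => x; rewrite /gamma_integrand /powR (negbTE tn0).
rewrite /gamma_integrand /powR (negbTE tn0).
have dL : is_derive z 1 (fun x : R => (x - 1) * ln t) (ln t).
  have d1 := is_deriveB (is_derive_id z (1 : R)) (is_derive_cst (1 : R) z 1).
  have := is_deriveM d1 (is_derive_cst (ln t) z (1 : R)).
  by rewrite /GRing.scale/= subr0 mulr0 add0r mulr1.
have := is_derive1_comp (f := @expR R) (g := fun x : R => (x - 1) * ln t)
  (is_derive_expR _) dL.
move=> /(is_deriveZ (expR (- t))) /is_derive_eq; apply.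
by rewrite /GRing.scale/= mulrA.
Qed.

(** ln y < y at y = t^d and at y = t^-d bounds d ln t and - d ln t. *)
Lemma normr_ln_le {R : realType} (d t : R) : 0 < d -> 0 < t ->
  `|ln t| <= d^-1 * (t `^ d + t `^ (- d)).
Proof.
move=> d0 t0; rewrite mulrC ler_pdivlMr// mulrC -{1}(gtr0_norm d0) -normrM.
have h (r : R) : r * ln t <= t `^ r.
  by rewrite -ln_powR; apply/ltW/ln_sublinear/powR_gt0.
rewrite ler_norml; apply/andP; split.
  by rewrite lerNl -mulNr (le_trans (h (- d)))// lerDr powR_ge0.
by rewrite (le_trans (h d))// lerDl powR_ge0.
Qed.

(** A power of t is monotone in its exponent, in a direction that depends on
    whether t <= 1: the exponent m controls t <= 1 and M controls t >= 1. *)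
Lemma gamma_integrand_le_ends {R : realType} (m M z t : R) : 0 < t ->
  m <= z <= M ->
  gamma_integrand z t <= gamma_integrand m t + gamma_integrand M t.
Proof.
move=> t0 /andP[mz zM]; rewrite -mulrDr ler_wpM2l ?expR_ge0//.
have [t1|t1] := leP t 1.
  rewrite (@le_trans _ _ (t `^ (m - 1)))// ?lerDl ?powR_ge0//.
  by apply: ger_powR; rewrite ?t0// lerD2r.
rewrite (@le_trans _ _ (t `^ (M - 1)))// ?lerDr ?powR_ge0//.
by rewrite ler_powR ?(ltW t1)// lerD2r.
Qed.

Lemma gamma_integrand_powR {R : realType} (z r t : R) : 0 < t ->
  gamma_integrand z t * t `^ r = gamma_integrand (z + r) t.
Proof.
move=> t0; rewrite /gamma_integrand -mulrA -powRD ?(gt_eqF t0) ?implybT//.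
by rewrite addrAC.
Qed.

(** For z in ]a/2, 2a[ and d = a/4, the exponents z - d and z + d stay in
    [a/4, 3a], hence the dominating function H. *)
Lemma derivable_Gamma {R : realType} (a : R) : 0 < a ->
  derivable (@Gamma R) a 1.
Proof.
move=> a0; pose d := a / 4; have d0 : 0 < d by rewrite divr_gt0.
pose H t := 2 / d * (gamma_integrand (a / 4) t + gamma_integrand (3 * a) t).
have H0 t : 0 <= H t.
  by rewrite mulr_ge0 ?addr_ge0 ?gamma_integrand_ge0// divr_ge0// ltW.
apply: (@derivable_under_integral R _ _ lebesgue_measure
  (@gamma_integrand R) `]0, +oo[ _ a (a / 2) (2 * a) _ _ _ H) => //.
- by rewrite /= in_itv/=; lra.
- move=> z /=; rewrite in_itv/= => /andP[az _].
  by apply: integrable_gamma_integrand; lra.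
- move=> z t /= _; rewrite in_itv/= andbT => t0.
  by have [] := is_derive_gamma_integrand z t t0.
- rewrite /H; under [X in _.-integrable _ X]eq_fun do rewrite /= EFinM EFinD.
  apply: integrableZl => //; apply: integrableD => //.
    by apply: integrable_gamma_integrand; lra.
  by apply: integrable_gamma_integrand; lra.
move=> z t /=; rewrite !in_itv/= andbT => /andP[az za] t0.
have [_] := is_derive_gamma_integrand z t t0.
rewrite partial1of2E => ->.
rewrite normrM ger0_norm ?gamma_integrand_ge0//.
apply: (@le_trans _ _ (gamma_integrand z t * (d^-1 * (t `^ d + t `^ (- d))))).
  by rewrite ler_wpM2l ?gamma_integrand_ge0// normr_ln_le.
rewrite mulrCA mulrDr !gamma_integrand_powR// /H -mulrA mulrCA.
rewrite ler_pM2l ?invr_gt0// mulrDl mul1r.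
by apply: lerD; apply: gamma_integrand_le_ends => //; rewrite /d; lra.
Qed.

(** Only the values on A enter the restricted difference quotient, so f may be
    replaced on A by a function that is differentiable in the ordinary sense. *)
Lemma derivable_within_eq {R : realType} (A : set R) (f g : R -> R) (a : R) :
  A a -> {in A, f =1 g} -> derivable g a 1 -> derivable_within A f a.
Proof.
move=> Aa fg /cvg_ex[/= l gl]; apply/cvg_ex; exists l.
apply/cvgrPdist_lt => e e0.
move/cvgrPdist_lt : gl => /(_ e e0)[r /= r0 rl].
exists r => //= q /= aq qa Aq.
have := rl (q - a); rewrite /= sub0r normrN distrC; move=> /(_ aq).
rewrite subr_eq0 => /(_ qa).
rewrite /GRing.scale/= mulr1 subrK mulrC.
by rewrite -!fg ?inE.
Qed.

Lemma derivable_pi_p_formula {R : realType} (p : R) : 0 < p ->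
  derivable (fun q : R => 2 * Gamma (1 / q) ^+ 2 / (q * Gamma (2 / q))) p 1.
Proof.
move=> p0; have pn0 : p != 0 by rewrite gt_eqF.
have dG (c : R) : 0 < c -> derivable (fun q : R => Gamma (c / q)) p 1.
  move=> c0; apply: diff_derivable.
  have dc : differentiable (fun q : R => c / q) p.
    by apply/derivable1_diffP; apply: derivableM => //; exact: derivableV.
  apply: (differentiable_comp dc); apply/derivable1_diffP.
  by apply: derivable_Gamma; rewrite divr_gt0.
have d1 := dG _ ltr01; have d2 := dG _ (ltr0Sn R 1).
have dN := derivableM (derivable_cst (2 : R) p 1) (derivableM d1 d1).
have di : derivable (@id R) p 1 by exact: derivable_id.
have dD := derivableM di d2.
have D0 : (id * (fun q : R => Gamma (2 / q))) p != 0.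
  by rewrite fctE mulf_neq0// gt_eqF// Gamma_gt0// divr_gt0.
have := derivableM dN (derivableV D0 dD).
by congr (derivable _ p 1); apply/funext => q; rewrite expr2.
Qed.

Theorem proposition4p3 (R : realType) :
  (forall p : R, 1 <= p ->
     pi_p p = 2 * Gamma (1 / p) ^+ 2 / (p * Gamma (2 / p))) /\
  (forall p : R, 1 <= p -> derivable_within `[1, +oo[ (@pi_p R) p).
Proof.
split=> p p1; have p0 := lt_le_trans ltr01 p1; first exact: pi_pE.
apply: (derivable_within_eq _ _ _ _ _ _ (derivable_pi_p_formula p p0)).
  by rewrite /= in_itv/= p1.
move=> q; rewrite inE/= in_itv/= andbT => /(lt_le_trans ltr01).
exact: pi_pE.
Qed.
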